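(* Let $n\ge 2$ be an integer. For each $q\in\mathsf{Q}_{12}=\{4,8,12,20,24,36,40,60,72,120,180,360\}$, the set $$\left\{e^{i\frac{2\pi}{q}r}\,\Sigma_j^{(k)} \;:\; j=0,1,2,3,\ r=0,1,\dots,q-1,\ k=1,\dots,n-1\right\}\cup\{\mathbf{0}\}$$ of $q$-generalized phase-shifted $n$-ary elementary $\Sigma$-matrices together with the zero matrix $\mathbf{0}$ of size $2(n-1)\times2(n-1)$ is, under the $n$-ary multiplication $\mu^{[n]}[A_1,\dots,A_n]=A_1A_2\cdots A_n$ (ordinary matrix product), a finite $n$-ary semigroup with zero, of order $4q(n-1)+1$. The $12$ $n$-ary semigroups obtained for $q\in\mathsf{Q}_{12}$ are pairwise non-isomorphic.
   Context: The $\sigma$-matrices are $\sigma_0=I_2$, $\sigma_1=\begin{pmatrix}0&1\\1&0\end{pmatrix}$, $\sigma_2=\begin{pmatrix}0&-i\\i&0\end{pmatrix}$, $\sigma_3=\begin{pmatrix}1&0\\0&-1\end{pmatrix}$. Matrices of size $2(n-1)\times 2(n-1)$ are viewed as $(n-1)\times(n-1)$ block matrices with $2\times2$ complex blocks. For $j\in\{0,1,2,3\}$ and $k\in\{1,\dots,n-1\}$, the polyadic elementary $\Sigma$-matrix $\Sigma_j^{(k)}$ is the block matrix with exactly one non-zero block, equal to $\sigma_j$, placed in block position $(k,k+1)$ if $k\le n-2$ and in block position $(n-1,1)$ if $k=n-1$. An $n$-ary semigroup is a set $S$ with a map $\mu:S^n\to S$ that is totally associative: in an expression with $2n-1$ arguments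 $\mu[a_1,\dots,a_i,\mu[a_{i+1},\dots,a_{i+n}],a_{i+n+1},\dots,a_{2n-1}]$ the value does not depend on $i\in\{0,\dots,n-1\}$. A zero is an element $z\in S$ such that $\mu[a_1,\dots,a_n]=z$ whenever some $a_i=z$. Isomorphisms are bijections compatible with the $n$-ary multiplications. *)

(* Defs.v *)
From HB Require Import structures.
From mathcomp Require Import all_boot all_order all_algebra.
From mathcomp Require Import all_classical all_reals all_analysis.
From mathcomp Require Import complex.

Set Implicit Arguments.
Unset Strict Implicit.
Unset Printing Implicit Defensive.

Import Order.TTheory GRing.Theory Num.Theory.

Local Open Scope classical_set_scope.
Local Open Scope complex_scope.
Local Open Scope ring_scope.

(* The value of mu[a_0, ..., mu[a_i, ..., a_(i+n-1)], a_(i+n), ..., a_(2n-2)];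
   only the first 2n-1 terms of the sequence a matter when i < n. *)
Definition nary_bracket (n : nat) (T : Type) (mu : {ffun 'I_n -> T} -> T)
    (a : nat -> T) (i : nat) : T :=
  mu [ffun l : 'I_n => if (l < i)%N then a l
                       else if l == i :> nat then mu [ffun m : 'I_n => a (i + m)%N]
                       else a (l + n.-1)%N].

Definition nary_semigroup (n : nat) (T : Type) (S : set T)
    (mu : {ffun 'I_n -> T} -> T) : Prop :=
  (forall a : {ffun 'I_n -> T}, (forall i, S (a i)) -> S (mu a)) /\
  (forall a : nat -> T, (forall m, (m < 2 * n - 1)%N -> S (a m)) ->
     forall i j, (i < n)%N -> (j < n)%N ->
       nary_bracket mu a i = nary_bracket mu a j).

Definition nary_zero (n : nat) (T : Type) (S : set T)
    (mu : {ffun 'I_n -> T} -> T) (z : T) : Prop :=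
  S z /\
  forall a : {ffun 'I_n -> T}, (forall i, S (a i)) -> (exists i, a i = z) ->
    mu a = z.

Definition nary_isomorphic (n : nat) (T T' : Type)
    (S : set T) (mu : {ffun 'I_n -> T} -> T)
    (S' : set T') (mu' : {ffun 'I_n -> T'} -> T') : Prop :=
  exists f : T -> T', set_bij S S' f /\
    forall a : {ffun 'I_n -> T}, (forall i, S (a i)) ->
      f (mu a) = mu' [ffun i => f (a i)].

Definition expi (R : realType) (t : R) : R[i] := cos t +i* sin t.

Definition mx2 (K : Type) (a b c d : K) : 'M[K]_2 :=
  \matrix_(i, j) if i == 0 then (if j == 0 then a else b)
                 else (if j == 0 then c else d).

Definition sigma (R : realType) (j : 'I_4) : 'M[R[i]]_2 :=
  match val j with
  | 0 => 1%:M
  | 1 => mx2 0 1 1 0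
  | 2 => mx2 0 (- 'i%C) 'i%C 0
  | _ => mx2 1 0 0 (- 1)
  end.

(* The dimension of block matrices with n-1 row and column blocks of size 2,
   in the form in which \mxblock produces it. *)
Notation block_size n := (\sum_(i < n.-1) 2)%N.

Lemma block_sizeE n : block_size n = (2 * (n - 1))%N.
Proof. by rewrite sum_nat_const card_ord mulnC subn1. Qed.

(* k and the block positions (k, k+1) and (n-1, 1) are counted from 1, whereas
   the block indices s and t are counted from 0. *)
Definition Sigma (R : realType) (n : nat) (j : 'I_4) (k : nat) :
    'M[R[i]]_(block_size n) :=
  \mxblock_(s < n.-1, t < n.-1)
    (if (s.+1 == k) && (t.+1 == if (k <= n - 2)%N then k.+1 else 1%N)
     then sigma R j else 0).

Definition phase_shifted_Sigma (R : realType) (n q : nat) :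
    set 'M[R[i]]_(block_size n) :=
  [set A | exists (j : 'I_4) (r k : nat),
     [/\ (r < q)%N, (1 <= k <= n - 1)%N &
         A = expi (2 * pi / q%:R * r%:R) *: Sigma R n j k]]
  `|` [set 0].
Arguments phase_shifted_Sigma : clear implicits.

Definition mulmx_nary (R : realType) (n : nat)
    (A : {ffun 'I_n -> 'M[R[i]]_(block_size n)}) : 'M[R[i]]_(block_size n) :=
  \prod_(i < n) A i.
Arguments mulmx_nary : clear implicits.

Definition Q12 : seq nat :=
  [:: 4; 8; 12; 20; 24; 36; 40; 60; 72; 120; 180; 360]%N.

(* Main.v *)
(* A phased sigma-matrix in block position (k, k+1), cyclically, advances the
   block index by one. A product of n of them is therefore either zero or a
   product of n phased sigma-matrices in position (k, k+n) = (k, k+1), because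
   indices live modulo n-1. Since 4 divides q, the phases contain i, and
   the phased sigma-matrices form a group. The semigroups for different q are
   not isomorphic because their orders differ. *)

Require Import Defs.
From mathcomp Require Import all_boot all_order all_algebra.
From mathcomp Require Import all_classical all_reals all_analysis.
From mathcomp Require Import complex ring lra zify.

Import Order.TTheory GRing.Theory Num.Theory.

Local Open Scope classical_set_scope.
Local Open Scope card_scope.
Local Open Scope ring_scope.

(** * Iterated products in a ring and counting of finite types *)

Lemma nary_bracket_prod (A : pzSemiRingType) (n : nat) (a : nat -> A) (i : nat) :
  (i < n)%N ->
  nary_bracket (fun b : {ffun 'I_n -> A} => \prod_(l < n) b l) a i =
  \prod_(0 <= l < 2 * n - 1) a l.
Proof.
move=> lt_in; rewrite /nary_bracket.
rewrite /=; under [LHS]eq_bigr do rewrite ffunE.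
have -> : \prod_(m < n) [ffun m : 'I_n => a (i + m)%N] m = \prod_(i <= m < i + n) a m.
  under [LHS]eq_bigr do rewrite ffunE addnC.
  by rewrite -(big_mkord xpredT (fun m => a (m + i)%N)) -{2}(add0n i) big_addn addKn.
set b := \prod_(i <= m < i + n) a m.
rewrite -(big_mkord xpredT
  (fun l => if (l < i)%N then a l else if l == i then b else a (l + n.-1)%N)).
(* The outer product splits into the factors before the bracket, the bracket [b] at index [i], and
   the factors after it, whose indices are shifted by [n.-1]; the flat product is then cut at [i]
   and [i + n] to match. *)
rewrite (@big_cat_nat _ _ _ i) //=; last exact: ltnW.
rewrite (big_ltn lt_in) ltnn eqxx.
rewrite [RHS](@big_cat_nat _ _ _ i) //=; last lia.
rewrite [X in _ = _ * X](@big_cat_nat _ _ _ (i + n)) //=; [|lia|lia].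
congr (_ * (_ * _)).
  by apply: eq_big_nat => l /= ->.
have -> : (i + n = i.+1 + n.-1)%N by lia.
rewrite big_addn; have -> : (2 * n - 1 - n.-1 = n)%N by lia.
apply: eq_big_nat => l /andP[lt_il _].
by rewrite ltnNge (ltnW lt_il) /= gtn_eqF.
Qed.

Lemma prod_eq0 (A : pzSemiRingType) (n : nat) (F : 'I_n -> A) (i : 'I_n) :
  F i = 0 -> \prod_(l < n) F l = 0.
Proof.
move=> Fi0; have := mem_index_enum i.
(* Without commutativity the zero factor cannot be moved to the front, so the index list is split
   around it. *)
by case/splitPr => s1 s2; rewrite big_cat big_cons /= Fi0 mul0r mulr0.
Qed.

Lemma card_setT_ord (T : finType) : [set: T] #= `I_#|T|.
Proof.
have <- : (fun x : T => enum_rank x : nat) @` [set: T] = `I_#|T|.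
  apply/seteqP; split=> [_ [x _ <-] /=|k /= ltk]; first exact: ltn_ord.
  by exists (enum_val (Ordinal ltk)); rewrite ?enum_valK.
rewrite card_eq_sym; apply: inj_card_eq => x y _ _ /ord_inj.
exact: enum_rank_inj.
Qed.

(** * Block matrices with a single non-zero block, and their cyclic weight *)

Section BlockElementary.
Variables (K : comPzRingType) (N : nat).
Implicit Types (s t : 'I_N) (A B : 'M[K]_2).

(** The Kronecker product $E_{st}\otimes A$ of a matrix unit with [A]. *)
Definition block_delta s t A : 'M[K]_(\sum_(i < N) 2) :=
  \mxblock_(s' < N, t' < N) if (s' == s) && (t' == t) then A else 0.

Lemma mul_block_delta s t s' t' A B :
  block_delta s t A *m block_delta s' t' B =
  if t == s' then block_delta s t' (A *m B) else 0.
Proof.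
rewrite /block_delta mul_mxblock.
have [<-|neq] := eqVneq t s'; last first.
  rewrite -[RHS]mxblock0; apply: eq_mxblock => i k.
  apply: big1 => j _; have [->|_] := eqVneq j t; last by rewrite andbF mul0mx.
  by rewrite (negPf neq) mulmx0.
apply: eq_mxblock => i k; rewrite (bigD1 t) //= eqxx andbT big1 => [|j /negPf->].
  rewrite addr0; case: (i == s); case: (k == t') => //=;
  by rewrite ?mul0mx ?mulmx0.
by rewrite andbF mul0mx.
Qed.

Lemma scale_block_delta c s t A :
  c *: block_delta s t A = block_delta s t (c *: A).
Proof.
apply/mxblockP => i j; rewrite mxblockK; apply/matrixP => k l.
have := mxblockK (fun s' t' => if (s' == s) && (t' == t) then A else 0) i j.
move=> /matrixP/(_ k l); rewrite !mxE => ->.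
by case: ifP; rewrite !mxE ?mulr0.
Qed.

Lemma block_delta_inj s t s' t' A B : A != 0 ->
  block_delta s t A = block_delta s' t' B -> [/\ s = s', t = t' & A = B].
Proof.
move=> A0; rewrite /block_delta => /eq_mxblockP/(_ s t); rewrite !eqxx /=.
by case: ifP => [/andP[/eqP-> /eqP->] ->|_ /eqP]; rewrite ?(negPf A0).
Qed.

Lemma block_delta_eq0 s t A : block_delta s t A = 0 -> A = 0.
Proof.
rewrite -[X in _ = X](@mxblock0 K N N (fun=> 2%N) (fun=> 2%N)) /block_delta.
by move=> /eq_mxblockP/(_ s t); rewrite !eqxx.
Qed.

(* The matrices whose only nonzero block, if any, lies in [G] and [m] steps
   cyclically above the diagonal; the weight [m] is additive under products. *)
Definition shifted (G : 'M[K]_2 -> Prop) (m : nat) (X : 'M[K]_(\sum_(i < N) 2)) :=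
  X = 0 \/ exists s A, G A /\ X = block_delta s (iter m (@ordS N) s) A.

Lemma shifted_mul (G : 'M[K]_2 -> Prop) m p X Y :
  (forall A B, G A -> G B -> G (A *m B)) ->
  shifted G m X -> shifted G p Y -> shifted G (p + m) (X *m Y).
Proof.
move=> Gmul [->|[s [A [GA ->]]]]; first by left; rewrite mul0mx.
move=> [->|[t [B [GB ->]]]]; first by left; rewrite mulmx0.
rewrite mul_block_delta; case: eqP => [<-|_]; last by left.
by right; exists s, (A *m B); rewrite iterD; split=> //; apply: Gmul.
Qed.

(** The induction starts at one factor: the empty product is the identity, which in general has more
    than one non-zero block. *)
Lemma shifted_prod (G : 'M[K]_2 -> Prop) m (F : 'I_m.+1 -> 'M[K]_(\sum_(i < N) 2)) :
  (forall A B, G A -> G B -> G (A *m B)) ->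
  (forall i, shifted G 1 (F i)) -> shifted G m.+1 (\prod_(i < m.+1) F i).
Proof.
move=> Gmul; elim: m F => [|m IH] F HF.
  by rewrite big_ord_recl big_ord0 mulr1; apply: HF.
by rewrite big_ord_recr; apply: (@shifted_mul G m.+1 1) => //; apply: IH.
Qed.

Lemma val_iter_ordS m s : iter m (@ordS N) s = ((s + m) %% N)%N :> nat.
Proof.
elim: m => [|m IH]; first by rewrite addn0 modn_small.
by rewrite iterS /= IH -addn1 modnDml addn1 addnS.
Qed.

Lemma iter_ordS_order s : iter N (@ordS N) s = s.
Proof. by apply: val_inj; rewrite /= val_iter_ordS modnDr modn_small. Qed.

(** [N] of the [N.+1] steps close the cycle. With $N = n-1$ this is why products of $n$ factors have
    weight one again. *)
Lemma shifted_order G X : shifted G N.+1 X -> shifted G 1 X.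
Proof.
case=> [->|[s [A [GA ->]]]]; first by left.
by right; exists s, A; rewrite iterS iter_ordS_order.
Qed.

End BlockElementary.

Arguments block_delta {K N}.
Arguments block_delta_inj {K N s t s' t' A B}.
Arguments shifted {K N}.

(** * Phases on the unit circle and the algebra of the sigma-matrices *)

Section Phases.
Variable R : realType.
Implicit Types (x y : R) (j k : 'I_4).

Lemma expi0 : expi (0 : R) = 1.
Proof. by rewrite /expi cos0 sin0. Qed.

Lemma expiD x y : expi (x + y) = expi x * expi y.
Proof.
rewrite /expi cosD sinD; apply/eqP; rewrite eq_complex /= eqxx /=.
by rewrite addrC [cos x * sin y]mulrC mulrC.
Qed.

Lemma expi_neq0 x : expi x != 0.
Proof.
apply/eqP => x0; have := expiD x (- x); rewrite subrr expi0 x0 mul0r => /eqP.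
by rewrite oner_eq0.
Qed.

Lemma expiMn x (m : nat) : expi (x * m%:R) = expi x ^+ m.
Proof.
elim: m => [|m IH]; first by rewrite mulr0 expi0.
by rewrite -addn1 natrD mulrDr mulr1 expiD IH exprD expr1.
Qed.

Lemma expi_2pi : expi (2 * pi : R) = 1.
Proof. by rewrite /expi mulr_natl cos2pi sin2pi. Qed.

Lemma expi_pihalf : expi (pi / 2 : R) = 'i%C.
Proof. by rewrite /expi cos_pihalf sin_pihalf. Qed.

Lemma expi_neq1 x : 0 < x < 2 * pi -> expi x != 1.
Proof.
move=> /andP[x0 xpi]; apply/eqP => -[cos1 _].
(* Since $\cos x = 1 - 2\sin^2(x/2)$, the equation $\cos x = 1$ would force $\sin(x/2) = 0$, while
   $x/2$ lies strictly between $0$ and $\pi$. *)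
have sin0 : 0 < sin (x / 2) by apply: sin_gt0_pi; apply/andP; split; lra.
have x2 : x = (x / 2) *+ 2 by rewrite -mulr_natr; field.
move: cos1; rewrite x2 cos_mulr2n cos2sin2; nra.
Qed.

Lemma expi_inj x y : 0 <= x < 2 * pi -> 0 <= y < 2 * pi ->
  expi x = expi y -> x = y.
Proof.
wlog lexy : x y / x <= y => [wl|].
  by have [/wl//|/ltW/wl w] := leP x y => hx hy /esym e; rewrite -w.
move=> /andP[x0 _] /andP[_ ypi]; have -> : y = x + (y - x) by ring.
(* Cancelling [expi x] leaves [expi (y - x) = 1], where [y - x] lies in $[0, 2\pi)$. *)
rewrite expiD => /esym/eqP; rewrite -subr_eq0 -{2}[expi x]mulr1 -mulrBr mulf_eq0.
rewrite (negPf (expi_neq0 x)) /= subr_eq0 => e; apply/eqP.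
rewrite eq_le; apply/andP; split; first by lra.
rewrite leNgt; apply/negP => lt.
by move: e; apply/negP/expi_neq1/andP; split; lra.
Qed.

Lemma complex_i_neq0 : 'i%C != 0 :> R[i].
Proof. by rewrite eq_complex /= oner_eq0 andbF. Qed.

Lemma mul_mx2 (K : pzRingType) (a b c d a' b' c' d' : K) :
  mx2 a b c d *m mx2 a' b' c' d' =
  mx2 (a * a' + b * c') (a * b' + b * d') (c * a' + d * c') (c * b' + d * d').
Proof.
apply/matrixP => i j; rewrite !mxE !big_ord_recl big_ord0 !mxE /= addr0.
by case: (i == 0); case: (j == 0).
Qed.

Lemma scale_mx2 (K : pzRingType) (e a b c d : K) :
  e *: mx2 a b c d = mx2 (e * a) (e * b) (e * c) (e * d).
Proof.
apply/matrixP => i j; rewrite !mxE.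
by case: (i == 0); case: (j == 0).
Qed.

Lemma mx2_inj (K : pzRingType) (a b c d a' b' c' d' : K) :
  mx2 a b c d = mx2 a' b' c' d' -> [/\ a = a', b = b', c = c' & d = d'].
Proof.
move=> /matrixP e; move: (e 0 0) (e 0 1) (e 1 0) (e 1 1).
by rewrite !mxE.
Qed.

Lemma scalar_mx2 (K : pzRingType) : 1%:M = mx2 1 0 0 1 :> 'M[K]_2.
Proof.
apply/matrixP => i j; rewrite !mxE.
by case: i j => [[|[|//]] ?] [[|[|//]] ?].
Qed.

(** The Pauli multiplication table: two distinct factors among $\sigma_1,\sigma_2,\sigma_3$ give the
    third, times $i$ in cyclic order and $-i = i^3$ otherwise; this explains the witnesses 1 and
    3. *)
Lemma sigma_mul j k :
  exists m l, sigma R j *m sigma R k = 'i%C ^+ m *: sigma R l.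
Proof.
have ii := sqr_i R.
pose o0 := @Ordinal 4 0 isT; pose o1 := @Ordinal 4 1 isT.
pose o2 := @Ordinal 4 2 isT; pose o3 := @Ordinal 4 3 isT.
case: j => -[|[|[|[|//]]]] ?; case: k => -[|[|[|[|//]]]] ?.
- by exists 0, o0; rewrite mul1mx scale1r.
- by exists 0, o1; rewrite mul1mx scale1r.
- by exists 0, o2; rewrite mul1mx scale1r.
- by exists 0, o3; rewrite mul1mx scale1r.
- by exists 0, o1; rewrite mulmx1 scale1r.
- exists 0, o0; rewrite /sigma /= scalar_mx2 mul_mx2 scale_mx2; congr mx2; ring: ii.
- exists 1, o3; rewrite /sigma /= mul_mx2 scale_mx2; congr mx2; ring: ii.
- exists 3, o2; rewrite /sigma /= mul_mx2 scale_mx2; congr mx2; ring: ii.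
- by exists 0, o2; rewrite mulmx1 scale1r.
- exists 3, o3; rewrite /sigma /= mul_mx2 scale_mx2; congr mx2; ring: ii.
- exists 0, o0; rewrite /sigma /= scalar_mx2 mul_mx2 scale_mx2; congr mx2; ring: ii.
- exists 1, o1; rewrite /sigma /= mul_mx2 scale_mx2; congr mx2; ring: ii.
- by exists 0, o3; rewrite mulmx1 scale1r.
- exists 1, o2; rewrite /sigma /= mul_mx2 scale_mx2; congr mx2; ring: ii.
- exists 3, o1; rewrite /sigma /= mul_mx2 scale_mx2; congr mx2; ring: ii.
- exists 0, o0; rewrite /sigma /= scalar_mx2 mul_mx2 scale_mx2; congr mx2; ring: ii.
Qed.

Lemma scale_sigma_inj (c c' : R[i]) j k : c != 0 ->
  c *: sigma R j = c' *: sigma R k -> j = k /\ c = c'.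
Proof.
move=> c0.
have c0F : c = 0 -> False by apply/eqP.
have iI (x y : R[i]) : x * 'i%C = y * 'i%C -> x = y.
  exact/mulIf/complex_i_neq0.
(* Two sigma-matrices with the same support ($\sigma_0,\sigma_3$ or $\sigma_1,\sigma_2$) differ in
   the relative sign of their entries; [dbl] and [dblN] turn that clash into a zero. Different
   supports make an entry vanish outright. *)
have dbl (x y : R[i]) : x = y -> x = - y -> x = 0.
  by move=> <- /eqP; rewrite eq_sym eqNr => /eqP.
have dblN (x y : R[i]) : x = y -> - x = y -> x = 0.
  by move=> <- /eqP; rewrite eqNr => /eqP.
have E i : sigma R i = match val i with
  | 0 => mx2 1 0 0 1 | 1 => mx2 0 1 1 0
  | 2 => mx2 0 (- 'i%C) 'i%C 0 | _ => mx2 1 0 0 (- 1) end.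
  by rewrite -scalar_mx2.
rewrite !E; case: j => -[|[|[|[|//]]]] ?; case: k => -[|[|[|[|//]]]] ?;
  rewrite /= !scale_mx2 => /mx2_inj []; rewrite !(mulr0, mulr1, mulrN1, mulrN) => *;
  try (by split; [exact: val_inj | first [done | exact/iI/oppr_inj]]);
  exfalso; apply: c0F;
  first [done | by apply: (dbl _ c') | by apply: (dblN _ c')
        | by apply: (dbl _ (c' * 'i%C)) | by apply: iI; rewrite mul0r; apply: (dblN _ c')
        | by apply/iI/oppr_inj; rewrite mul0r oppr0].
Qed.

End Phases.

Arguments expi_inj {R x y}.
Arguments scale_sigma_inj {R c c' j k}.

(** * Closure and cardinality of the set of phase-shifted matrices *)

Section PhaseShiftedSigma.
Variable R : realType.

Definition phased_sigma (q : nat) (A : 'M[R[i]]_2) :=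
  exists (j : 'I_4) (r : 'I_q), A = expi (2 * pi / q%:R * r%:R) *: sigma R j.

(** As $e^{2\pi i/q}$ is a $q$-th root of unity, exponents produced by products can be brought back
    below [q]. *)
Lemma expi_mod (q r : nat) : (0 < q)%N ->
  expi (2 * pi / q%:R * r%:R : R) = expi (2 * pi / q%:R * (r %% q)%:R).
Proof.
move=> q0; have zq : expi (2 * pi / q%:R : R) ^+ q = 1.
  by rewrite -expiMn divfK ?expi_2pi // pnatr_eq0 -lt0n.
by rewrite !expiMn {1}(divn_eq r q) exprD mulnC exprM zq expr1n mul1r.
Qed.

Lemma phased_sigma_mul (q : nat) (A B : 'M[R[i]]_2) : (4 %| q)%N ->
  phased_sigma q A -> phased_sigma q B -> phased_sigma q (A *m B).
Proof.
move=> q4 [j [r ->]] [k [p ->]].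
have q0 : (0 < q)%N by apply: leq_ltn_trans (ltn_ord r).
have zi : 'i%C = expi (2 * pi / q%:R : R) ^+ (q %/ 4).
  rewrite -expiMn -expi_pihalf; congr expi.
  rewrite -{1}(divnK q4) natrM; field.
  by rewrite pnatr_eq0 -lt0n divn_gt0 // dvdn_leq.
have [e [l eq]] := sigma_mul R j k.
(* The exponents [r] and [p] come from the two phases; each of the [e] factors $i$ adds [q %/ 4]. *)
have ltq : ((r + p + q %/ 4 * e) %% q < q)%N by rewrite ltn_pmod.
exists l, (Ordinal ltq).
rewrite /= -expi_mod // -scalemxAl -scalemxAr eq zi !scalerA !expiMn.
by rewrite !exprD exprM.
Qed.

Lemma phased_sigma_inj (q : nat) (j k : 'I_4) (r p : 'I_q) :
  expi (2 * pi / q%:R * r%:R) *: sigma R j =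
  expi (2 * pi / q%:R * p%:R) *: sigma R k -> j = k /\ r = p.
Proof.
move=> /(scale_sigma_inj (expi_neq0 _ _))[-> e]; split=> //.
have q0 : 0 < q%:R :> R by rewrite ltr0n; apply: leq_ltn_trans (ltn_ord r).
have pi2 : 0 < 2 * pi / q%:R :> R by rewrite divr_gt0 // mulr_gt0 ?pi_gt0.
have bound (t : 'I_q) : 0 <= 2 * (pi : R) / q%:R * t%:R < 2 * pi.
  have e2pi : 2 * pi = 2 * pi / q%:R * q%:R :> R by rewrite divfK ?lt0r_neq0.
  rewrite mulr_ge0 ?(ltW pi2) //=.
  by rewrite [ltRHS]e2pi ltr_pM2l // ltr_nat.
move: e => /(expi_inj (bound _) (bound _))/(mulfI (lt0r_neq0 pi2))/eqP.
by rewrite eqr_nat => /eqP/val_inj.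
Qed.

Lemma sigma_neq0 (j : 'I_4) : sigma R j != 0.
Proof.
(* If [sigma R j] vanished, the scalars $1$ and $-1$ would give the same multiple of it. *)
apply/eqP => e; have := @scale_sigma_inj R 1 (-1) j j (oner_neq0 _).
by rewrite e !scaler0 => /(_ erefl)[_ /eqP]; rewrite eq_sym eqNr oner_eq0.
Qed.

(** The next block and the wrap-around from row $n-1$ to column $1$ are both the cyclic successor
    [ordS] on $n-1$ = [m.+1] indices. *)
Lemma SigmaE (m : nat) (j : 'I_4) (s : 'I_m.+1) :
  Sigma R m.+2 j s.+1 = block_delta s (ordS s) (sigma R j).
Proof.
apply: eq_mxblock => i k /=; congr (if _ && _ then _ else _).
rewrite -val_eqE /= subn2 /=; have := ltn_ord s; rewrite ltnS leq_eqVlt.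
case/orP => [/eqP->|lt]; first by rewrite ltnn modnn eqSS.
by rewrite lt modn_small ?eqSS.
Qed.

Lemma phase_shifted_SigmaP (m q : nat) (X : 'M[R[i]]_(block_size m.+2)) :
  phase_shifted_Sigma R m.+2 q X <-> shifted (phased_sigma q) 1 X.
Proof.
split=> [[[j [r [k [ltrq]]]]|->]|[->|[s [A [[j [r ->]] ->]]]]].
- case: k => // k ltk ->; right.
  have ltkm : (k < m.+1)%N by move: ltk; rewrite subn1.
  exists (Ordinal ltkm), (expi (2 * pi / q%:R * r%:R) *: sigma R j).
  split; first by exists j, (Ordinal ltrq).
  by rewrite (SigmaE m j (Ordinal ltkm)) scale_block_delta.
- by left.
- by right.
- left; exists j, r, s.+1; rewrite SigmaE scale_block_delta subn1.
  by split; [exact: ltn_ord | exact: (ltn_ord s) |].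
Qed.

Lemma phase_shifted_Sigma_closed (m q : nat)
    (a : {ffun 'I_m.+2 -> 'M[R[i]]_(block_size m.+2)}) : (4 %| q)%N ->
  (forall i, phase_shifted_Sigma R m.+2 q (a i)) ->
  phase_shifted_Sigma R m.+2 q (mulmx_nary R m.+2 a).
Proof.
move=> q4 Sa; apply/phase_shifted_SigmaP/shifted_order/shifted_prod => [A B|i].
  exact: phased_sigma_mul.
exact/phase_shifted_SigmaP.
Qed.

Lemma card_phase_shifted_Sigma (m q : nat) :
  phase_shifted_Sigma R m.+2 q #= `I_(4 * q * m.+1 + 1).
Proof.
(* An injective parametrization: [None] stands for the zero matrix and accounts for the [+ 1]. *)
pose f (x : option ('I_4 * 'I_q * 'I_m.+1)) : 'M[R[i]]_(block_size m.+2) :=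
  if x is Some (j, r, s) then
    block_delta s (ordS s) (expi (2 * pi / q%:R * r%:R) *: sigma R j)
  else 0.
have -> : phase_shifted_Sigma R m.+2 q = f @` [set: _].
  apply/seteqP; split=> [X /phase_shifted_SigmaP[->|[s [A [[j [r ->]] ->]]]]|_ [x _ <-]].
  - by exists None.
  - by exists (Some (j, r, s)).
  - apply/phase_shifted_SigmaP; case: x => [[[j r] s]|]; last by left.
    by right; exists s; eexists; split; [exists j, r|].
have f_neq0 j (r : 'I_q) : expi (2 * pi / q%:R * r%:R) *: sigma R j != 0.
  by rewrite scaler_eq0 negb_or expi_neq0 sigma_neq0.
have <- : #|{: option ('I_4 * 'I_q * 'I_m.+1)}| = (4 * q * m.+1 + 1)%N.
  by rewrite card_option !card_prod !card_ord addn1.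
apply: card_eq_trans (card_setT_ord _); apply: inj_card_eq => x y _ _.
case: x => [[[j r] s]|]; case: y => [[[k p] t]|] //=.
- by case/(block_delta_inj (f_neq0 _ _)) => -> _ /phased_sigma_inj[-> ->].
- by move=> /block_delta_eq0 e; have := f_neq0 j r; rewrite e eqxx.
- by move=> /esym/block_delta_eq0 e; have := f_neq0 k p; rewrite e eqxx.
Qed.

End PhaseShiftedSigma.

Theorem proposition6p5 (R : realType) (n : nat) (n_ge2 : (2 <= n)%N) :
  (forall q : nat, q \in Q12 ->
     [/\ nary_semigroup (phase_shifted_Sigma R n q) (mulmx_nary R n),
         nary_zero (phase_shifted_Sigma R n q) (mulmx_nary R n) 0,
         finite_set (phase_shifted_Sigma R n q) &
         phase_shifted_Sigma R n q #= `I_(4 * q * (n - 1) + 1)]) /\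
  (forall q q' : nat, q \in Q12 -> q' \in Q12 -> q <> q' ->
     ~ nary_isomorphic (phase_shifted_Sigma R n q) (mulmx_nary R n)
                       (phase_shifted_Sigma R n q') (mulmx_nary R n)).
Proof.
case: n n_ge2 => [//|[//|m]] _.
have card q : phase_shifted_Sigma R m.+2 q #= `I_(4 * q * (m.+2 - 1) + 1).
  by rewrite subn1; apply: card_phase_shifted_Sigma.
split=> [q qQ|q q' _ _ neq [f [fbij _]]].
  have q4 : (4 %| q)%N by move: q qQ; apply/allP.
  split=> //; last by apply/finite_setP; eexists; apply: card.
    split=> [a|a _ i j lti ltj]; first exact: phase_shifted_Sigma_closed.
    by rewrite /mulmx_nary !nary_bracket_prod.
  by split=> [|a _ [i ai0]]; [right | apply: prod_eq0 ai0].
have [g _] := Pbij fbij.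
have := card_eq_trans (card_eq_trans (card_esym (card q)) (pcard_eq g)) (card q').
(* The bijection equates the two orders, and $4q(n-1)+1$ determines $q$ because $n-1 > 0$. *)
by move=> /card_eq_II/eqP; rewrite eqn_add2r subn1 eqn_pmul2r // eqn_pmul2l // => /eqP.
Qed.
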